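(* Let $q$ be a prime power, $n$ a positive integer, $0<t\le n$ an integer and $b=1+q^t$, and assume that the polynomial $\mathrm{Tr}(X)=\mathrm{Tr}_b(X)$ has $m=q^{2n-1-t}+q^{2n-1}$ different roots in $\mathbb{F}_{q^{2n}}$ (denoted $\beta_1,\dots,\beta_m$, these being all its roots in $\mathbb{F}_{q^{2n}}$). Write $\mathrm{Tr}(X)=\sum_{k=0}^m a_kX^k$. Then $a_k=0$ for all indices $k$, with the exception of: - $k=0$; - $k=q^jb$, where $0\le j\le 2n-t-1$; - and, when $t<n$, $k=k_j:=q^{j-1}(1+q^{2n-t})$ for $1\le j\le t$. Thus $\mathrm{Tr}(X)$ has $2n+1$ non-zero coefficients $a_k$ when $t<n$, and it has $n+1$ otherwise ($t=n$). All the non-vanishing coefficients are equal to $1$.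
   Context: For a positive integer $j$ put $\mathrm{tr}_j(X)=X+X^q+\cdots+X^{q^{j-1}}$. For $b=1+q^t$ with $0<t\le n$, let $P_b(X)=1+\mathrm{tr}_{2n}(X^b)$ if $0<t<n$, and $P_b(X)=1+\mathrm{tr}_n(X^b)$ if $t=n$. The $b$th trace-depending polynomial $\mathrm{Tr}_b(X)\in\mathbb{F}_{q^{2n}}[X]$ is the representative of minimum degree of the class of $P_b(X)$ in $\mathbb{F}_{q^{2n}}[X]/\langle X^{q^{2n}-1}-1\rangle$. *)

(* Defs.v *)
From HB Require Import structures.
From mathcomp Require Import all_boot all_order all_algebra all_field.
Set Implicit Arguments.
Unset Strict Implicit.
Unset Printing Implicit Defensive.
Import GRing.Theory.
Local Open Scope ring_scope.

Definition prime_power (q : nat) : Prop :=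
  exists p e : nat, [/\ prime p, (0 < e)%N & q = (p ^ e)%N].

Definition tr_poly (R : nzRingType) (q j : nat) : {poly R} :=
  \sum_(i < j) 'X^(q ^ i).

(* The polynomial P_b for b = 1 + q ^ t; since 0 < t <= n,
   the else branch is the case t = n. *)
Definition P_poly (R : nzRingType) (q n t : nat) : {poly R} :=
  if (t < n)%N then 1 + (tr_poly R q (2 * n) \Po 'X^(1 + q ^ t))
  else 1 + (tr_poly R q n \Po 'X^(1 + q ^ t)).

(* T is a representative of minimum degree of the class of P in K[X] / <M>.
   Since size is the degree plus one, and 0 for the zero polynomial, zero is
   the minimum-degree representative of its class. *)
Definition min_degree_rep (K : fieldType) (M P T : {poly K}) : Prop :=
  M %| T - P /\ forall S : {poly K}, M %| S - P -> (size T <= size S)%N.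

(* For nonzero M there is exactly one such T. *)
Lemma min_degree_repE (K : fieldType) (M P T : {poly K}) :
  M != 0 -> min_degree_rep M P T <-> T = P %% M.
Proof.
move=> M0; have eqM (S : {poly K}) : (M %| S - P) = (S %% M == P %% M).
  by rewrite /dvdp modpD modpN subr_eq0.
split=> [[]|->].
  rewrite eqM => /eqP eqT /(_ (P %% M)).
  rewrite eqM modp_id eqxx => /(_ isT) leT.
  by rewrite -eqT modp_small // (leq_ltn_trans leT) // ltn_modp.
split=> [|S]; first by rewrite eqM modp_id.
rewrite eqM => /eqP <-.
have [ltS|leS] := ltnP (size S) (size M); first by rewrite modp_small.
by rewrite ltnW // (leq_trans _ leS) // ltn_modp.
Qed.

(* T is the trace-depending polynomial Tr_b, for b = 1 + q ^ t. *)
Definition is_trace_depending (K : fieldType) (q n t : nat) (T : {poly K}) :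
    Prop :=
  min_degree_rep ('X^(q ^ (2 * n) - 1) - 1) (P_poly K q n t) T.

(* Main.v *)
Require Import Defs.
From HB Require Import structures.
From mathcomp Require Import all_boot all_order all_algebra all_field.
From mathcomp Require Import zify.
Set Implicit Arguments.
Unset Strict Implicit.
Unset Printing Implicit Defensive.
Import GRing.Theory.
Local Open Scope ring_scope.

(* Modulo 'X^(q ^ (2 * n) - 1) - 1 the exponent q ^ i + q ^ (i + t) becomes
   q ^ i + q ^ ((i + t) %% (2 * n)), a sum of two distinct powers of q with
   exponents below 2 * n. Such a sum determines the two powers, so for
   0 < t <= n no two monomials collide, and the largest reduced exponent is m.
   As m < q ^ (2 * n) - 1 unless q = 2 and n = 1, the reduced sum of monomials
   is Tr. In the exceptional case Tr is the constant 2, which has 0 or 4 roots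
   in F rather than m = 3. *)

(** * Sums of two distinct powers of [q] *)

Lemma trunc_log_addX (q a c : nat) :
  (1 < q)%N -> (a < c)%N -> trunc_log q (q ^ a + q ^ c) = c.
Proof.
(* As [q >= 2], we have [q ^ c <= q ^ a + q ^ c < 2 * q ^ c <= q ^ c.+1]. *)
move=> q1 ac; apply: trunc_log_eq => //; rewrite leq_addl /= expnS.
have : (q ^ a < q ^ c)%N by rewrite ltn_exp2l.
by nia.
Qed.

(** The larger exponent is the integer logarithm of the sum; cancelling its power leaves the smaller
    one. *)
Lemma addX_inj (q a c a' c' : nat) :
  (1 < q)%N -> (a < c)%N -> (a' < c')%N ->
  (q ^ a + q ^ c = q ^ a' + q ^ c')%N -> a = a' /\ c = c'.
Proof.
move=> q1 ac ac' E.
have Ec : c = c' by rewrite -(trunc_log_addX q1 ac) E trunc_log_addX.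
split=> //; move/eqP: E; rewrite Ec eqn_add2r eqn_exp2l //.
by move/eqP.
Qed.

(** * Monomials and their sums *)

Lemma dvdp_XnD_mul_sub (K : fieldType) (d c a : nat) :
  'X^d - 1 %| ('X^(a + d * c) - 'X^a : {poly K}).
Proof.
have -> : 'X^(a + d * c) - 'X^a = 'X^a * ('X^(d * c) - 1) :> {poly K}.
  by rewrite exprD mulrBr mulr1.
by rewrite exprM (subrX1 'X^d) dvdp_mull // dvdp_mulIl.
Qed.

Lemma coef_sumXn (R : nzRingType) (s : seq nat) (k : nat) :
  uniq s -> (\sum_(i <- s) 'X^i : {poly R})`_k = (k \in s)%:R.
Proof.
elim: s => [|i s IH] /=; first by rewrite big_nil coef0.
move=> /andP[si us]; rewrite big_cons coefD coefXn (IH us) inE.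
by have [->|_] := eqVneq k i; rewrite ?(negPf si) ?addr0 ?add0r.
Qed.

Lemma size_sumXn (R : nzRingType) (s : seq nat) (m : nat) :
  all (leq^~ m) s -> (size (\sum_(i <- s) 'X^i : {poly R})%R <= m.+1)%N.
Proof.
move=> /allP sm; apply/leq_sizeP => k mk; rewrite coef_sum big1_seq // => i.
by move=> /sm im; rewrite coefXn gtn_eqF // (leq_ltn_trans im).
Qed.

Lemma card_ord_mem (m : nat) (s : seq nat) :
  uniq s -> all (leq^~ m) s -> #|[set k : 'I_m.+1 | (k : nat) \in s]| = size s.
Proof.
move=> us /allP sm; rewrite cardsE cardE -(size_map val).
apply: perm_size; apply: uniq_perm => //.
  by rewrite map_inj_uniq ?enum_uniq //; apply: val_inj.
move=> k; apply/mapP/idP => [[i]|ks]; first by rewrite mem_enum => ? ->.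
by exists (inord k); rewrite ?mem_enum ?unfold_in /= ?inordK // ltnS sm.
Qed.

(** * The exponents of [P_poly] reduced modulo [q ^ (2 * n) - 1] *)

Section ReducedExponents.

Variables q n t : nat.
Hypothesis q1 : (1 < q)%N.
Hypothesis ht : (0 < t <= n)%N.

Definition nb_monomials : nat := if (t < n)%N then (2 * n)%N else n.

(** For [i < 2 * n], [low_exp i] and [high_exp i] are the smaller and the larger of [i] and
    [(i + t) %% 2n]: after a wrap, [i + t - 2 * n < i] since [t < 2 * n]. *)
Definition low_exp (i : nat) : nat :=
  if (i + t < 2 * n)%N then i else (i + t - 2 * n)%N.

Definition high_exp (i : nat) : nat :=
  if (i + t < 2 * n)%N then (i + t)%N else i.

Definition red_exp (i : nat) : nat := (q ^ low_exp i + q ^ high_exp i)%N.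

(** The leading 0 is the exponent of the constant term 1. *)
Definition red_exps : seq nat :=
  0%N :: [seq red_exp i | i <- iota 0 nb_monomials].

Lemma nb_monomials_le : (nb_monomials <= 2 * n)%N.
Proof. by rewrite /nb_monomials; case: ifP; lia. Qed.

Lemma low_lt_high i : (low_exp i < high_exp i)%N.
Proof. by move: ht; rewrite /low_exp /high_exp; case: ifP; lia. Qed.

Lemma red_exp_gt0 i : (0 < red_exp i)%N.
Proof. by rewrite addn_gt0 expn_gt0 (ltnW q1). Qed.

(** Equal pairs force [i = j] when both or neither wrap. If just one wraps, the gaps [t] and
    [2 * n - t] agree, so [t = n]; but then only indices below [n] occur and none wraps. *)
Lemma red_exp_inj i j :
  (i < nb_monomials)%N -> (j < nb_monomials)%N -> red_exp i = red_exp j ->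
  i = j.
Proof.
move=> Ni Nj /(addX_inj q1 (low_lt_high i) (low_lt_high j)) [].
move: Ni Nj ht; rewrite /low_exp /high_exp /nb_monomials.
by case: ifP; case: ifP; case: ifP; lia.
Qed.

Lemma red_exps_uniq : uniq red_exps.
Proof.
rewrite /= map_inj_in_uniq ?iota_uniq ?andbT.
  by apply/mapP => -[i _ E]; have := red_exp_gt0 i; rewrite -E.
by move=> i j; rewrite !mem_iota !add0n /=; apply: red_exp_inj.
Qed.

(** The two exponents are bounded separately. After a wrap the lower one is at most [t - 1], which
    is at most [2 * n - 1 - t] because [t <= n]. *)
Lemma red_exps_le :
  all (leq^~ (q ^ (2 * n - 1 - t) + q ^ (2 * n - 1))%N) red_exps.
Proof.
apply/allP => k; rewrite inE => /predU1P[-> //|/mapP[i]].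
rewrite mem_iota add0n /= => Ni ->; have N2 := nb_monomials_le.
by apply: leq_add; rewrite leq_exp2l //; move: ht;
  rewrite /low_exp /high_exp; case: ifP; lia.
Qed.

Lemma dvdp_red_exp (K : fieldType) i :
  'X^(q ^ (2 * n) - 1) - 1
    %| ('X^(red_exp i) - 'X^((1 + q ^ t) * q ^ i) : {poly K}).
Proof.
rewrite /red_exp /low_exp /high_exp mulnDl mul1n -expnD [(t + i)%N]addnC.
case: ifP => [_|lt2n]; first by rewrite subrr dvdp0.
set j := (i + t - 2 * n)%N.
(* Since [i + t = j + 2 * n], the wrap lowers the exponent by a multiple of [q ^ (2 * n) - 1]. *)
have -> : (q ^ (i + t) = q ^ j + (q ^ (2 * n) - 1) * q ^ j)%N.
  rewrite -mulSn -subSn ?expn_gt0 ?(ltnW q1) // subn1 /= -expnD.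
  by congr (_ ^ _)%N; lia.
by rewrite addnA [(q ^ i + _)%N]addnC -dvdpNr opprB dvdp_XnD_mul_sub.
Qed.

Lemma P_polyE (R : nzRingType) :
  P_poly R q n t = 1 + \sum_(i < nb_monomials) 'X^((1 + q ^ t) * q ^ i).
Proof.
rewrite /P_poly /nb_monomials; case: ifP => _; congr (_ + _);
  rewrite /tr_poly raddf_sum /=; apply: eq_bigr => i _;
  by rewrite comp_Xn_poly exprM.
Qed.

Lemma red_exps_sumE (R : nzRingType) :
  \sum_(k <- red_exps) 'X^k =
    1 + \sum_(i < nb_monomials) 'X^(red_exp i) :> {poly R}.
Proof.
rewrite big_cons big_map expr0; congr (_ + _).
by rewrite -(big_mkord xpredT (fun i => 'X^(red_exp i))) /index_iota subn0.
Qed.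

Lemma dvdp_red_exps (K : fieldType) :
  'X^(q ^ (2 * n) - 1) - 1 %| \sum_(k <- red_exps) 'X^k - P_poly K q n t.
Proof.
rewrite red_exps_sumE P_polyE opprD addrACA subrr add0r -sumrB.
apply: (big_ind (fun p : {poly K} => _ %| p)) => [|? ?|i _].
- exact: dvdp0.
- exact: dvdp_add.
- exact: dvdp_red_exp.
Qed.

Lemma mem_red_exps k :
  k \in red_exps <->
  [\/ k = 0%N,
      exists2 j : nat, (j <= 2 * n - t - 1)%N & k = (q ^ j * (1 + q ^ t))%N
    | (t < n)%N /\
      exists2 j : nat, (1 <= j <= t)%N &
        k = (q ^ (j - 1) * (1 + q ^ (2 * n - t)))%N].
Proof.
rewrite inE; split=> [/predU1P[->|/mapP[i]]|].
- by constructor 1.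
- rewrite mem_iota add0n /= /red_exp /low_exp /high_exp /nb_monomials => Ni ->.
  case: ifP => it.
    by constructor 2; exists i; [move: ht; lia | rewrite mulnDr muln1 expnD].
  (* For [t = n] the index stays below [n], so no wrap could occur. *)
  have tn : (t < n)%N by move: Ni; case: ifP => //; lia.
  rewrite tn in Ni; constructor 3; split=> //.
  exists (i + t - 2 * n).+1; first by lia.
  rewrite subn1 /= mulnDr muln1 -expnD; congr (_ + _ ^ _)%N; lia.
- case=> [->//|[j jle ->]|[tn [j jle ->]]]; apply/orP; right; apply/mapP.
    exists j.
      by rewrite mem_iota add0n /= /nb_monomials; move: ht; case: ifP; lia.
    rewrite /red_exp /low_exp /high_exp ifT ?ifT; [|move: ht; lia..].
    by rewrite mulnDr muln1 expnD.
  (* The wrapped index whose reduction [i + t - 2 * n] equals [j - 1]. *)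
  exists (j - 1 + (2 * n - t))%N.
    by rewrite mem_iota add0n /= /nb_monomials tn; lia.
  rewrite /red_exp /low_exp /high_exp ifF ?ifF; [|lia..].
  by rewrite mulnDr muln1 -expnD; congr (_ ^ _ + _)%N; lia.
Qed.

(** With [B = q ^ (2 * n - 2)] the left side is at most [B + q * B + 1], and the right side is
    [q ^ 2 * B]. For [q >= 3] this suffices; for [q = 2] it reads [3 * B + 1 < 4 * B], which needs
    [B > 1], that is [n > 1]. *)
Lemma max_exp_lt :
  (q != 2) || (n != 1) ->
  ((q ^ (2 * n - 1 - t) + q ^ (2 * n - 1)).+1 < q ^ (2 * n))%N.
Proof.
move=> qn.
have [k nE] : exists k, n = k.+1 by exists n.-1; move: ht; lia.
have E1 : (q ^ (2 * n - 1) = q * q ^ (2 * k))%N.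
  by rewrite -expnS; congr (_ ^ _)%N; lia.
have E2 : (q ^ (2 * n) = q * (q * q ^ (2 * k)))%N.
  by rewrite -!expnS; congr (_ ^ _)%N; lia.
have le : (q ^ (2 * n - 1 - t) <= q ^ (2 * k))%N.
  by rewrite leq_exp2l //; move: ht; lia.
have B0 : (0 < q ^ (2 * k))%N by rewrite expn_gt0 (ltnW q1).
have [q2|q2] := eqVneq q 2; last by rewrite E1 E2; nia.
have B1 : (1 < q ^ (2 * k))%N.
  by rewrite -{1}(expn0 q) ltn_exp2l //; move: qn; rewrite q2 /=; lia.
by rewrite E1 E2; move: le B1; rewrite q2; lia.
Qed.

Lemma trace_depending_red_exps (K : fieldType) (T : {poly K}) :
  (q != 2) || (n != 1) -> is_trace_depending q n t T ->
  T = \sum_(k <- red_exps) 'X^k.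
Proof.
move=> /max_exp_lt lt.
have d0 : (0 < q ^ (2 * n) - 1)%N by lia.
move=> /(min_degree_repE _ _ (monic_neq0 (monicXnsubC 1 d0))) ->.
have := dvdp_red_exps K; rewrite /dvdp modpD modpN subr_eq0 => /eqP <-.
(* The modulus has size [q ^ (2 * n)], which exceeds the size of the sum, so the sum is its own
   remainder. *)
rewrite modp_small // size_XnsubC //.
by apply: leq_ltn_trans (size_sumXn _ red_exps_le) _; lia.
Qed.

End ReducedExponents.

(** * The exceptional case and the conclusion *)

Lemma prime_power_gt1 q : prime_power q -> (1 < q)%N.
Proof.
move=> [p [e [pp e0 ->]]].
by rewrite -(expn0 p) ltn_exp2l // prime_gt1.
Qed.

Lemma card_roots_exceptional (F : finFieldType) (T : {poly F}) :
  #|F| = 4 -> is_trace_depending 2 1 1 T -> #|[set x : F | root T x]| != 3.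
Proof.
have M0 : 'X^3 - 1 != 0 :> {poly F} by rewrite monic_neq0 // monicXnsubC.
move=> F4 /(min_degree_repE _ _ M0) ->.
have -> : P_poly F 2 1 1 %% ('X^3 - 1) = 2%:P.
  rewrite /P_poly /= /tr_poly big_ord1 expr1 comp_polyX.
  have -> : 1 + 'X^(1 + 2) = 1 * ('X^3 - 1) + 2%:P :> {poly F}.
    by rewrite mul1r polyCD addrA subrK addrC.
  rewrite modpD modp_mull add0r modp_small // size_XnsubC //.
  exact: leq_ltn_trans (size_polyC_leq1 _) _.
(* If 2 vanishes in [F], all 4 elements are roots; otherwise none is. *)
have [E|E] := eqVneq (2 : F) 0.
  by rewrite (eq_card (B := predT)) ?F4 // => x; rewrite !inE E root0.
by rewrite eq_card0 // => x; rewrite !inE rootC (negPf E).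
Qed.

Theorem proposition6 (q n t b m : nat) (F : finFieldType) (Tr : {poly F})
  (hq : prime_power q) (hn : (0 < n)%N) (ht : (0 < t <= n)%N)
  (hb : b = (1 + q ^ t)%N)
  (hm : m = (q ^ (2 * n - 1 - t) + q ^ (2 * n - 1))%N)
  (hF : #|F| = (q ^ (2 * n))%N)
  (hTr : is_trace_depending q n t Tr)
  (hroots : #|[set x : F | root Tr x]| = m) :
  [/\ Tr = \sum_(k < m.+1) Tr`_k *: 'X^k,
      forall k : nat, (k <= m)%N ->
        (Tr`_k <> 0 <->
         [\/ k = 0%N,
             exists2 j : nat, (j <= 2 * n - t - 1)%N & k = (q ^ j * b)%N
           | (t < n)%N /\
             exists2 j : nat, (1 <= j <= t)%N &
               k = (q ^ (j - 1) * (1 + q ^ (2 * n - t)))%N]),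
      #|[set k : 'I_m.+1 | Tr`_k != 0]| =
        (if (t < n)%N then 2 * n + 1 else n + 1)%N
    & forall k : nat, (k <= m)%N -> Tr`_k <> 0 -> Tr`_k = 1].
Proof.
have q1 := prime_power_gt1 hq.
(* The root count excludes [q = 2], [n = 1], where it would have to be 3. *)
have qn : (q != 2) || (n != 1).
  rewrite -negb_and; apply/negP => /andP[/eqP q2 /eqP n1].
  have t1 : t = 1%N by move: ht; rewrite n1; lia.
  subst q n t; have := card_roots_exceptional hF hTr.
  by rewrite hroots hm.
have us := red_exps_uniq q1 ht; have le := red_exps_le q1 ht.
rewrite -hm in le.
have TrE := trace_depending_red_exps q1 ht qn hTr.
have coefTr k : Tr`_k = (k \in red_exps q n t)%:R by rewrite TrE coef_sumXn.
have coefTr_neq0 k : (Tr`_k != 0) = (k \in red_exps q n t).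
  by rewrite coefTr; case: (_ \in _); rewrite ?oner_eq0 ?eqxx.
split.
- have sz : (size Tr <= m.+1)%N by rewrite TrE size_sumXn.
  apply/polyP => k; rewrite -poly_def coef_poly.
  by case: ltnP => // lek; rewrite nth_default // (leq_trans sz).
- move=> k _; rewrite hb -(mem_red_exps q1 ht) -coefTr_neq0.
  by split=> /eqP.
(* The exponents are distinct and at most [m], so the nonzero coefficients are counted by the length
   of the list. *)
- transitivity (size (red_exps q n t)).
    rewrite -(card_ord_mem us le).
    by apply: eq_card => k; rewrite !inE coefTr_neq0 inE.
  by rewrite /= size_map size_iota /nb_monomials; case: ifP; rewrite addn1.
- by move=> k _ /eqP; rewrite coefTr_neq0 coefTr => ->.
Qed.
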